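(* \[\lim_{k\to\infty}\lim_{N\to\infty}\frac{\log G'_{k}(N)}{\log N}=1\quad\text{if and only if}\quad\lim_{k\to\infty}\lim_{N\to\infty}\frac{\log F'_{k}(N)}{\log N}=1.\]
   Context: $G'_k(N)$ is the size of the smallest set of integers that contains a $k$-term arithmetic progression $\{x+r,\dots,x+kr\}$ ($r\ne0$) with basepoint $x$, for $N$ distinct integer values of $x$. $F'_k(N)$ is the size of the smallest set of integers containing a $k$-term arithmetic progression with common difference $d$ for $N$ distinct integer values of $d$. *)

(* Defs.v *)
From mathcomp Require Import all_boot all_order all_algebra finmap.
From mathcomp Require Import all_classical all_reals all_analysis.
Set Implicit Arguments.
Unset Strict Implicit.
Unset Printing Implicit Defensive.
Import Order.TTheory GRing.Theory Num.Theory.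
Import numFieldNormedType.Exports.
Local Open Scope classical_set_scope.
Local Open Scope ring_scope.

(* The progression is {x + r, ..., x + k r}: the basepoint x is not one of the
   listed terms, and r != 0 makes the k terms distinct. *)
Definition contains_AP (k : nat) (A : {fset int}) (x r : int) : Prop :=
  r != 0 /\ forall i : nat, (1 <= i <= k)%N -> x + r *+ i \in A.

Definition has_basepoints (k N : nat) (A : {fset int}) : Prop :=
  exists X : {fset int}, #|` X| = N /\
    forall x, x \in X -> exists r, contains_AP k A x r.

Definition has_differences (k N : nat) (A : {fset int}) : Prop :=
  exists D : {fset int}, #|` D| = N /\
    forall d, d \in D -> exists x, contains_AP k A x d.

Definition is_size (P : {fset int} -> Prop) (n : nat) : bool :=
  `[< exists A : {fset int}, P A /\ #|` A| = n >].

Definition int_segment (m n : nat) : {fset int} :=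
  [fset Posz i | i in iota m n]%fset.

Lemma mem_int_segment (m n i : nat) :
  (m <= i < m + n)%N -> Posz i \in int_segment m n.
Proof. by move=> h; apply/imfsetP; exists i => //=; rewrite mem_iota. Qed.

Lemma card_int_segment (m n : nat) : #|` int_segment m n| = n.
Proof.
rewrite card_imfset /=; last by move=> i j [].
by rewrite (undup_id (iota_uniq _ _)) size_iota.
Qed.

Lemma ex_basepoints_size (k N : nat) : exists n, is_size (has_basepoints k N) n.
Proof.
exists #|` int_segment 0 (N + k)|; apply/asboolP.
exists (int_segment 0 (N + k)); split=> //.
exists (int_segment 0 N); split; first exact: card_int_segment.
move=> _ /imfsetP[j /= jN ->]; exists 1; split=> // i /andP[_ ik].
rewrite natz -PoszD; apply: mem_int_segment.
move: jN; rewrite mem_iota /= !add0n => jN.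
by rewrite -addSn leq_add.
Qed.

Lemma ex_differences_size (k N : nat) :
  exists n, is_size (has_differences k N) n.
Proof.
exists #|` int_segment 0 (N * k).+1|; apply/asboolP.
exists (int_segment 0 (N * k).+1); split=> //.
exists (int_segment 1 N); split; first exact: card_int_segment.
move=> _ /imfsetP[j /= jN ->]; move: jN; rewrite mem_iota => /andP[j0 jN].
exists 0; split; first by rewrite -lt0n.
move=> i /andP[_ ik]; rewrite add0r -mulr_natr natz -PoszM.
by apply: mem_int_segment; rewrite /= add0n ltnS leq_mul.
Qed.

(* G'_k(N) *)
Definition Gp (k N : nat) : nat := ex_minn (ex_basepoints_size k N).

(* F'_k(N) *)
Definition Fp (k N : nat) : nat := ex_minn (ex_differences_size k N).

(* lim_k lim_N log H_k(N) / log N = l, the inner limits being required to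
   exist; k = 0 is left out because the minimal set is then empty. *)
Definition iterated_log_lim (R : realType) (H : nat -> nat -> nat) (l : R)
    : Prop :=
  exists L : nat -> R,
    (forall k : nat, (1 <= k)%N ->
       (fun N : nat => ln ((H k N)%:R : R) / ln (N%:R : R)) @ \oo --> L k) /\
    L @ \oo --> l.

(* Main.v *)
(* A progression is a pair [(x, r)] of a basepoint and a difference.  If [A]
   contains [x + i r] for [1 <= i <= k!], then the union of the dilates [j A],
   [1 <= j <= k], contains [j (x + (k!/j) r) = k! r + j x], so it contains a
   [k]-term progression with basepoint [k! r] and difference [x].  Hence
   [G'_k(N) <= k F'_{k!}(N)] and [F'_k(N) <= k G'_{k!}(N)].  Both functions are
   submultiplicative in [N], so the inner limits exist by Fekete's lemma; they
   are nondecreasing in [k] and at most 1, so one family tends to 1 as soon as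
   the other does. *)
Require Import Defs.
From mathcomp Require Import all_boot all_order all_algebra.
From mathcomp Require Import all_classical all_reals all_analysis.
From mathcomp Require Import finmap zify ring lra.
Import Order.TTheory GRing.Theory Num.Theory.
Import numFieldNormedType.Exports.
Local Open Scope classical_set_scope.
Local Open Scope ring_scope.

(** * A common form for the two extremal functions *)

(* The boolean [b] selects what has to be distinct: basepoints ([false],
   [G'_k]) or differences ([true], [F'_k]). *)
Definition min_size (b : bool) : nat -> nat -> nat := if b then Fp else Gp.

Definition coord (b : bool) (p : int * int) : int := if b then p.2 else p.1.

(** Here [A] is a list in which entries may repeat, so an upper bound on [min_size] needs only a
    list of candidate terms and no proof that they are distinct. *)
Definition progressions (b : bool) (k N : nat) (A : seq int)
    (S : seq (int * int)) : Prop :=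
  [/\ uniq (map (coord b) S), size S = N &
      forall p, p \in S -> p.2 != 0 /\
        forall i : nat, (1 <= i <= k)%N -> p.1 + p.2 *+ i \in A].

Lemma min_size_le (b : bool) (k N : nat) (A : seq int) (S : seq (int * int)) :
  progressions b k N A S -> (min_size b k N <= size A)%N.
Proof.
case=> uS sS AS; apply: (@leq_trans #|` seq_fset tt A|).
  case: b uS => uS; rewrite /min_size /Fp /Gp; case: ex_minnP => m _; apply.
  - apply/asboolP; exists (seq_fset tt A); split=> //.
    exists (seq_fset tt (map (coord true) S)); split.
      by rewrite size_seq_fset undup_id // size_map.
    move=> d; rewrite seq_fsetE => /mapP[p /AS[p0 pA] ->]; exists p.1.
    by split=> // i /pA; rewrite seq_fsetE.
  - apply/asboolP; exists (seq_fset tt A); split=> //.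
    exists (seq_fset tt (map (coord false) S)); split.
      by rewrite size_seq_fset undup_id // size_map.
    move=> d; rewrite seq_fsetE => /mapP[p /AS[p0 pA] ->]; exists p.2.
    by split=> // i /pA; rewrite seq_fsetE.
by rewrite size_seq_fset size_undup.
Qed.

Lemma min_size_attained (b : bool) (k N : nat) :
  exists A S, progressions b k N A S /\ size A = min_size b k N.
Proof.
case: b; rewrite /min_size /Fp /Gp.
- case: ex_minnP => m /asboolP[A [[D [cD AD]] cA]] _.
  have /choice[f fP] : forall d, exists x, d \in D -> contains_AP k A x d.
    move=> d; case: (boolP (d \in D)) => [/AD[x xP]|_]; last by exists 0.
    by exists x.
  exists A, [seq (f d, d) | d <- D]; split; last exact: cA.
  split; first by rewrite -map_comp map_id_in ?fset_uniq.
    by rewrite size_map.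
  by move=> _ /mapP[d dD ->] /=; have [] := fP _ dD.
- case: ex_minnP => m /asboolP[A [[X [cX AX]] cA]] _.
  have /choice[f fP] : forall x, exists r, x \in X -> contains_AP k A x r.
    move=> x; case: (boolP (x \in X)) => [/AX[r rP]|_]; last by exists 0.
    by exists r.
  exists A, [seq (x, f x) | x <- X]; split; last exact: cA.
  split; first by rewrite -map_comp map_id_in ?fset_uniq.
    by rewrite size_map.
  by move=> _ /mapP[x xX ->] /=; have [] := fP _ xX.
Qed.

(** * Bounds on the minimal sizes *)

Lemma min_size_gt0 (b : bool) (k N : nat) :
  (0 < k)%N -> (0 < N)%N -> (0 < min_size b k N)%N.
Proof.
move=> k0 N0; have [A [[|p S] [[_ sS AS] <-]]] := min_size_attained b k N.
  by rewrite -sS in N0.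
have [|_ /(_ 1%N)] := AS p; first exact: mem_head.
by rewrite k0 => /(_ isT); case: A {AS}.
Qed.

Lemma leq_min_size (b : bool) (k k' N N' : nat) :
  (k <= k')%N -> (N <= N')%N -> (min_size b k N <= min_size b k' N')%N.
Proof.
move=> kk' NN'; have [A [S [[uS sS AS] <-]]] := min_size_attained b k' N'.
apply: (@min_size_le _ _ _ _ (take N S)); split.
- by rewrite map_take take_uniq.
- by rewrite size_takel // sS.
- move=> p /mem_take /AS[p0 pA]; split=> // i /andP[i1 ik]; apply: pA.
  by rewrite i1 (leq_trans ik).
Qed.

(** The pairs [(i, i)] with [1 <= i <= N] serve both values of [b] at once: their terms [i (j + 1)]
    lie between 1 and [(k + 1) N]. *)
Lemma min_size_le_linear (b : bool) (k N : nat) :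
  (min_size b k N <= k.+1 * N)%N.
Proof.
rewrite -[X in (_ <= X)%N](size_iota 1) -(size_map Posz).
apply: (@min_size_le _ _ _ _ [seq (Posz i, Posz i) | i <- iota 1 N]); split.
- rewrite -map_comp map_inj_uniq ?iota_uniq // => i j /=.
  by case: b => -[].
- by rewrite size_map size_iota.
- move=> _ /mapP[i iN ->] /=; move: iN; rewrite mem_iota => /andP[i0 iN].
  split=> [|j /andP[j1 jk]]; first by rewrite -lt0n.
  have -> : i%:Z + i%:Z *+ j = Posz (i * j.+1).
    by rewrite -mulr_natr natz -PoszM -PoszD mulnS.
  apply/map_f; rewrite mem_iota; nia.
Qed.

(** The difference [a - a'] is a multiple of [2m + 1] of absolute value at most [2m], hence zero. *)
Lemma mixed_radix_inj (m : nat) (a a' c c' : int) :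
  (`|a| <= m)%N -> (`|a'| <= m)%N ->
  a + m.*2.+1%:Z * c = a' + m.*2.+1%:Z * c' -> a = a' /\ c = c'.
Proof.
move=> am am' e.
have {}e : m.*2.+1%:Z * (c' - c) = a - a' by rewrite mulrBr; lra.
suff c0 : c' - c = 0 by move: e; rewrite c0 mulr0; lia.
have [d0|d0|//] := ltgtP (c' - c) 0; nia.
Qed.

Lemma absz_bound (S : seq (int * int)) :
  exists m : nat, forall p, p \in S -> (`|p.1| <= m)%N /\ (`|p.2| <= m)%N.
Proof.
exists (\max_(p <- S) maxn `|p.1| `|p.2|)%N => p pS.
apply/andP; rewrite -geq_max.
exact: (@leq_bigmax_seq _ S xpredT (fun p => maxn `|p.1| `|p.2|)%N).
Qed.

(* The set [A + T B], with [T] so large that the pairs do not collide, plays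
   the role of the product set [A x B]. *)
Lemma min_size_mul (b : bool) (k M N : nat) :
  (min_size b k (M * N) <= min_size b k M * min_size b k N)%N.
Proof.
have [A [S [[uS sS AS] <-]]] := min_size_attained b k M.
have [A' [S' [[uS' sS' AS'] <-]]] := min_size_attained b k N.
have [m mS] := absz_bound S; set T := m.*2.+1%:Z.
rewrite -(size_allpairs (fun a c => a + T * c)).
apply: (@min_size_le _ _ _ _
  [seq (p.1 + T * q.1, p.2 + T * q.2) | p <- S, q <- S']); split.
- have -> : [seq coord b i
      | i <- [seq (p.1 + T * q.1, p.2 + T * q.2) | p <- S, q <- S']]
    = [seq x + T * y | x <- map (coord b) S, y <- map (coord b) S'].
    by rewrite map_allpairs allpairs_mapl allpairs_mapr; case: (b).
  apply: allpairs_uniq => // u v /allpairsP[[x y] /= [/mapP[p pS ->] _ ->]].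
  case/allpairsP=> [[x' y'] /= [/mapP[q qS ->] _ ->]] /=.
  have [[p1 p2] [q1 q2]] := (mS _ pS, mS _ qS).
  by case/mixed_radix_inj; [case: (b)|case: (b)|move=> -> ->].
- by rewrite size_allpairs sS sS'.
- move=> _ /allpairsP[[p q] /= [pS qS' ->]] /=.
  have [[p0 pA] [q0 qA]] := (AS _ pS, AS' _ qS'); split.
    (* A zero difference would have the same digits as [0 + T * 0], which forces [q.2 = 0]. *)
    apply/eqP => e; move/eqP: q0; apply.
    have [_ p2] := mS _ pS.
    by have [//||] := @mixed_radix_inj m p.2 0 q.2 0 p2; rewrite ?mulr0 ?addr0.
  move=> i ik; apply/allpairsP; exists (p.1 + p.2 *+ i, q.1 + q.2 *+ i) => /=.
  by split; [exact: pA|exact: qA|ring].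
Qed.

(* Translating [A] by [t] first makes the new differences [x + t] nonzero. *)
Lemma min_size_swap (b : bool) (k N : nat) :
  (min_size b k N <= k * min_size (~~ b) k`! N)%N.
Proof.
have [A [S [[uS sS AS] <-]]] := min_size_attained (~~ b) k`! N.
(* As [|p.1| <= m < t], every [p.1 + t] is positive. *)
have [m mS] := absz_bound S; set t := m.+1%:Z.
rewrite -[X in (_ <= X * _)%N](size_iota 1).
rewrite -(size_allpairs (fun j a => (a + t) *+ j)).
apply: (@min_size_le _ _ _ _ [seq (p.2 *+ k`!, p.1 + t) | p <- S]); split.
- move: uS; rewrite -map_comp.
  have -> : map (coord b \o (fun p => (p.2 *+ k`!, p.1 + t))) S =
    map (fun x => if b then x + t else x *+ k`!) (map (coord (~~ b)) S).
    by rewrite -map_comp; apply: eq_map => p /=; case: (b).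
  move=> uS; rewrite map_inj_uniq // => x y; case: (b); first exact: addIr.
  exact: (@pmulrnI _ k`! (fact_gt0 k)).
- by rewrite size_map.
- move=> _ /mapP[p pS ->] /=; have [p0 pA] := AS _ pS.
  split=> [|j /andP[j1 jk]].
    by have [+ _] := mS _ pS; rewrite /t; move: (p.1 : int) => x; lia.
  have jM : (j %| k`!)%N by apply: dvdn_fact; rewrite j1.
  apply/allpairsP; exists (j, p.1 + p.2 *+ (k`! %/ j)) => /=; split.
  + by rewrite mem_iota add1n ltnS j1.
  + by apply: pA; rewrite leq_div andbT divn_gt0 // dvdn_leq // fact_gt0.
  + by rewrite -[X in p.2 *+ X](divnK jM) mulrnA !mulrnDl; ring.
Qed.

(** * Limits of logarithmic ratios *)

Definition log_ratio {R : realType} (u : nat -> nat) (N : nat) : R :=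
  ln (u N)%:R / ln N%:R.

Lemma ln_nat_gt0 {R : realType} [N : nat] : (1 < N)%N -> 0 < ln (N%:R : R).
Proof. by move=> N1; rewrite ln_gt0 // ltr1n. Qed.

Lemma ln_nat_ge0 {R : realType} (N : nat) : 0 <= ln (N%:R : R).
Proof. by case: N => [|N]; [rewrite ln0|rewrite ln_ge0 // ler1n]. Qed.

Lemma ler_ln_nat {R : realType} (M N : nat) :
  (0 < M)%N -> (M <= N)%N -> ln (M%:R : R) <= ln N%:R.
Proof.
move=> M0 MN; rewrite ler_ln ?ler_nat // posrE ltr0n //.
exact: leq_trans MN.
Qed.

Lemma ln_natM {R : realType} (M N : nat) : (0 < M)%N -> (0 < N)%N ->
  ln ((M * N)%:R : R) = ln M%:R + ln N%:R.
Proof. by move=> M0 N0; rewrite natrM lnM ?posrE ?ltr0n. Qed.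

Lemma ln_natX {R : realType} (M n : nat) : (0 < M)%N ->
  ln ((M ^ n)%:R : R) = ln M%:R *+ n.
Proof. by move=> M0; rewrite natrX lnXn ?ltr0n. Qed.

Lemma cvg_div_ln {R : realType} (c : R) : c / ln (N%:R : R) @[N --> \oo] --> 0.
Proof.
apply/cvgrPdist_le => e e0.
have largeN : \forall N \near \oo, expR (`|c| / e) <= N%:R.
  exact: cvgry_ge cvgr_idn _.
near=> N.
have N1 : (1 < N)%N by near: N; exact: nbhs_infty_ge.
rewrite sub0r normrN normrM normfV (gtr0_norm (ln_nat_gt0 N1)).
rewrite ler_pdivrMr ?ln_nat_gt0 // mulrC -ler_pdivrMr //.
rewrite -[leLHS]expRK ler_ln ?posrE ?expR_gt0 ?ltr0n //; last exact: ltnW.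
by near: N.
Unshelve. all: by end_near. Qed.

(** The factor [c] adds only [ln c / ln N] to the ratio, and this tends to 0. *)
Lemma log_ratio_lim_le {R : realType} (u v : nat -> nat) (c : nat) (a b : R) :
  (forall N, 0 < N -> 0 < u N)%N -> (forall N, u N <= c * v N)%N ->
  log_ratio u @ \oo --> a -> log_ratio v @ \oo --> b -> a <= b.
Proof.
move=> u0 uv ua vb.
have vb' : ln (c%:R : R) / ln N%:R + log_ratio v N @[N --> \oo] --> b.
  by rewrite -[b]add0r; apply: cvgD => //; exact: cvg_div_ln.
apply: (ler_cvg_to ua vb'); near=> N.
have N1 : (1 < N)%N by near: N; exact: nbhs_infty_ge.
have uN0 : (0 < u N)%N by rewrite u0 // ltnW.
have : (0 < c * v N)%N by exact: leq_trans (uv N).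
rewrite muln_gt0 => /andP[c0 v0].
rewrite /log_ratio -mulrDl ler_wpM2r ?invr_ge0 ?ln_nat_ge0 //.
by rewrite -ln_natM // ler_ln_nat.
Unshelve. all: by end_near. Qed.

Lemma log_ratio_id_cvg {R : realType} :
  (log_ratio id : nat -> R) @ \oo --> (1 : R).
Proof.
apply: cvg_near_cst; near=> N.
rewrite /log_ratio divff // gt_eqF // ln_nat_gt0 //.
by near: N; exact: nbhs_infty_ge.
Unshelve. all: by end_near. Qed.

(* Fekete: the limit is the infimum of [log u N / log N] over [N >= 2]. *)
Lemma submultiplicative_log_ratio_cvg {R : realType} (u : nat -> nat) :
  (forall N, 0 < N -> 0 < u N)%N -> {homo u : M N / (M <= N)%N} ->
  (forall M N, u (M * N) <= u M * u N)%N ->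
  cvg ((log_ratio u : nat -> R) @ \oo).
Proof.
move=> u0 umono umul; apply/cvg_ex.
(* At [N <= 1] the quotient is 0 by the conventions for [ln 0] and division by zero; including it
   would pull the infimum down to 0. *)
pose E := [set (log_ratio u N : R) | N in [set N | (1 < N)%N]].
have Elb : lbound E 0.
  by move=> _ [N _ <-]; rewrite divr_ge0 // ln_nat_ge0.
have Einf : has_inf E.
  by split; [exists (log_ratio u 2); exists 2%N|exists 0].
exists (inf E); apply/cvgrPdist_le => e e0.
have e20 : 0 < e / 2 by rewrite divr_gt0.
have [_ [m /= m1 <-] mE] := inf_adherent e20 Einf.
have m0 : (0 < m)%N by exact: ltnW.
have uX j : (u (m ^ j.+1) <= u m ^ j.+1)%N.
  elim: j => [|j IH]; first by rewrite !expn1.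
  rewrite expnS [X in (_ <= X)%N]expnS (leq_trans (umul _ _)) //.
  by rewrite leq_mul2l IH orbT.
near=> N.
have N1 : (1 < N)%N by near: N; exact: nbhs_infty_ge.
have N0 : (0 < N)%N by exact: ltnW.
have lN := @ln_nat_gt0 R N N1; have lm := @ln_nat_gt0 R m m1.
have lower : inf E <= log_ratio u N by apply: ge_inf; [exists 0|exists N].
rewrite distrC ger0_norm ?subr_ge0 //.
(* With [m ^ j <= N < m ^ j.+1], monotonicity gives [u N <= u m ^ j.+1]. The first [j] factors
   contribute at most [log_ratio u m] because [j ln m <= ln N]; the one left over contributes
   [ln (u m) / ln N], which is at most [e / 2] for large [N]. *)
have /andP[jN Nj] := trunc_log_bounds m1 N0; set j := trunc_log m N in jN Nj.
have uN : ln ((u N)%:R : R) <= ln (u m)%:R *+ j.+1.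
  rewrite -ln_natX ?u0 //; apply: ler_ln_nat; first exact: u0.
  exact: leq_trans (umono _ _ (ltnW Nj)) (uX j).
have jlN : ln (m%:R : R) *+ j <= ln N%:R.
  by rewrite -ln_natX // ler_ln_nat // expn_gt0 m0.
have small : ln ((u m)%:R : R) / ln N%:R <= e / 2.
  apply: le_trans (ler_norm _) _; rewrite -[leLHS]normrN -sub0r.
  by near: N; apply: (cvgrPdist_le _ _).1 e20; exact: cvg_div_ln.
have : log_ratio u N <= log_ratio u m + ln ((u m)%:R : R) / ln N%:R.
  rewrite /log_ratio ler_pdivrMr // mulrDl divfK ?gt_eqF //.
  apply: (le_trans uN); rewrite mulrSr lerD2r -[leLHS]mulr_natr -mulrA.
  rewrite ler_wpM2l ?ln_nat_ge0 // mulrC ler_pdivlMr //.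
  by rewrite mulr_natl.
lra.
Unshelve. all: by end_near. Qed.

(** * Growth exponents and their comparison *)

Definition exponent (R : realType) (b : bool) (k : nat) : R :=
  lim (log_ratio (min_size b k) @ \oo).

Lemma cvg_exponent {R : realType} (b : bool) (k : nat) : (0 < k)%N ->
  log_ratio (min_size b k) @ \oo --> exponent R b k.
Proof.
move=> k0; apply: submultiplicative_log_ratio_cvg.
- by move=> N; exact: min_size_gt0.
- by move=> M N; exact: leq_min_size.
- exact: min_size_mul.
Qed.

Lemma exponent_le1 {R : realType} (b : bool) (k : nat) :
  (0 < k)%N -> exponent R b k <= 1.
Proof.
move=> k0; apply: (@log_ratio_lim_le _ (min_size b k) id k.+1).
- by move=> N; exact: min_size_gt0.
- exact: min_size_le_linear.
- exact: cvg_exponent.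
- exact: log_ratio_id_cvg.
Qed.

Lemma le_exponent {R : realType} (b : bool) (k k' : nat) :
  (0 < k)%N -> (k <= k')%N -> exponent R b k <= exponent R b k'.
Proof.
move=> k0 kk'; apply: (@log_ratio_lim_le _ (min_size b k) (min_size b k') 1).
- by move=> N; exact: min_size_gt0.
- by move=> N; rewrite mul1n leq_min_size.
- exact: cvg_exponent.
- exact: cvg_exponent (leq_trans k0 kk').
Qed.

Lemma exponent_swap {R : realType} (b : bool) (k : nat) :
  (0 < k)%N -> exponent R b k <= exponent R (~~ b) k`!.
Proof.
move=> k0; apply: (@log_ratio_lim_le _ (min_size b k) (min_size (~~ b) k`!) k).
- by move=> N; exact: min_size_gt0.
- exact: min_size_swap.
- exact: cvg_exponent.
- exact: cvg_exponent (fact_gt0 k).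
Qed.

Lemma iterated_log_lim_swap {R : realType} (b : bool) :
  iterated_log_lim (min_size b) (1 : R) ->
  iterated_log_lim (min_size (~~ b)) (1 : R).
Proof.
case=> L [LH L1]; exists (exponent R (~~ b)); split.
  by move=> k k0; exact: cvg_exponent.
apply/cvgrPdist_le => e e0.
have [K [K0 LK]] : exists K, (0 < K)%N /\ 1 - e <= L K.
  near \oo => K; exists K; split; first by near: K; exact: nbhs_infty_ge.
  by near: K; apply: (cvgr_ge _ L1); lra.
(* The given [L] agrees with [exponent R b] at [K] by uniqueness of limits. *)
have eL : exponent R b K = L K.
  by rewrite /exponent; apply: cvg_lim => //; exact: LH.
near=> k.
(* From [k = K!] on, [1 - e <= L K] passes to [exponent R (~~ b) k], first by the swap from [K] to
   [K!] and then by monotonicity. *)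
have kK : (K`! <= k)%N by near: k; exact: nbhs_infty_ge.
have k0 := leq_trans (fact_gt0 K) kK.
rewrite ger0_norm ?subr_ge0 ?exponent_le1 //.
have := @exponent_swap R b K K0.
have := @le_exponent R (~~ b) _ _ (fact_gt0 K) kK.
lra.
Unshelve. all: by end_near. Qed.

Theorem mainTheorem8 (R : realType) :
  iterated_log_lim Gp (1 : R) <-> iterated_log_lim Fp (1 : R).
Proof.
split; first exact: (@iterated_log_lim_swap R false).
exact: (@iterated_log_lim_swap R true).
Qed.
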